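(* Let $P$ be a standard, range-restricted logic program in which, whenever a variable $X$ occurs both in a term of the head and in a term of the body of a rule, at most one of these terms is complex, and every complex term has nesting depth at most one. Let $r$ be a rule of $P$. If $M[\![r]\!]$ is infinite, then for every natural number $k\ge1$, the rule $r$ depends on a cycle of $\Sigma_k(P)$.
   Context: A standard rule is $A\leftarrow B_1,\dots,B_k$ with atoms built from constants, variables and function symbols; a program is a finite set of rules. Immediate consequence operator: $T_P(I)=\{A\theta\mid A\leftarrow A_1,\dots,A_n\in P,\ \theta\text{ a ground substitution with }A_i\theta\in I\text{ for all }i\}$; $T_P^0(\emptyset)=\emptyset$, $T_P^i(\emptyset)=T_P(T_P^{i-1}(\emptyset))$. $M[\![r]\!]$ is the set of ground atoms $head(r)\theta$ such that $head(r)\theta\in T_P^i(\emptyset)\setminus T_P^{i-1}(\emptyset)$ for some $i\ge1$ (the facts inferred using $r$). Activation graph $\Sigma(P)$: nodes rules, edge $(r_1,r_2)$ iff $head(r_1)$ unifies with an atom of $body(r_2)$. A path $(r_1,r_2),\dots,(r_k,r_{k+1})$ of $\Sigma(P)$ is active if there are unifiers $\theta_1,\dots,\theta_k$ such that $head(r_1)$ unifies with an atom of $body(r_2)$ via $\theta_1$ and, for $i\in[2..k]$, $head(r_i)\theta_{i-1}$ unifies with an atom of $body(r_{i+1})$ via $\theta_i$. $\Sigma_k(P)$ has the rules as nodes and an edge $(r,s)$ iff there is an active path of length $k$ from $r$ to $s$. A node $r$ depends on a cycle if there is a path from some node of the cycle to $r$ (nodes on the cycle depend on it).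
   Formalization: M[[r]] counts only facts head(r)θ new at stage i whose body(r)θ already holds at stage i-1 (facts inferred using r); without this the claim fails for r: p(X)←q(X) with p(f(X))←p(X) and p(a). *)

(* Defs.v *)
From HB Require Import structures.
From mathcomp Require Import all_boot.
From mathcomp Require Import boolp classical_sets cardinality.

Set Implicit Arguments.
Unset Strict Implicit.
Unset Printing Implicit Defensive.

Local Open Scope classical_set_scope.

Record signature := Signature {
  const_sym : Type;
  fun_sym : Type;
  pred_sym : Type;
  farity : fun_sym -> nat;
  farity_gt0 : forall f : fun_sym, 0 < farity f;
  parity : pred_sym -> nat
}.

Inductive term (S : signature) : Type :=
  | Var of nat
  | Cst of const_sym S
  | App (f : fun_sym S) of {ffun 'I_(farity f) -> term S}.

Arguments Var {S} _.
Arguments Cst {S} _.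
Arguments App {S} f _.

Record atom (S : signature) := Atom {
  apred : pred_sym S;
  aargs : {ffun 'I_(parity apred) -> term S}
}.

Record rule (S : signature) := Rule {
  rhead : atom S;
  rbody : seq (atom S)
}.

(* The signature carries no decidable equality; membership in a sequence of
   atoms or rules is decided classically. *)
HB.instance Definition _ (S : signature) := gen_eqMixin (atom S).
HB.instance Definition _ (S : signature) := gen_eqMixin (rule S).

Fixpoint occurs S (x : nat) (t : term S) : bool :=
  match t with
  | Var y => x == y
  | Cst _ => false
  | App _ a => [exists i, occurs x (a i)]
  end.

Definition occurs_atom S (x : nat) (A : atom S) : bool :=
  [exists i, occurs x (aargs A i)].

Definition occurs_rule S (x : nat) (r : rule S) : bool :=
  occurs_atom x (rhead r) || has (occurs_atom x) (rbody r).

Definition complex S (t : term S) : bool :=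
  if t is App _ _ then true else false.

Fixpoint depth S (t : term S) : nat :=
  match t with
  | App _ a => (\max_i depth (a i)).+1
  | _ => 0
  end.

(* Only the values on the finitely many variables of the expression at hand
   matter, so substitutions are not required to have finite support. *)
Definition substitution S := nat -> term S.

Fixpoint subst S (th : substitution S) (t : term S) : term S :=
  match t with
  | Var x => th x
  | Cst c => Cst c
  | App f a => App f [ffun i => subst th (a i)]
  end.

Definition subst_atom S (th : substitution S) (A : atom S) : atom S :=
  @Atom S (apred A) [ffun i => subst th (aargs A i)].

Definition subst_rule S (th : substitution S) (r : rule S) : rule S :=
  Rule (subst_atom th (rhead r)) (map (subst_atom th) (rbody r)).

Definition ground S (t : term S) : Prop := forall x, ~~ occurs x t.

Definition ground_subst S (th : substitution S) : Prop :=
  forall x, ground (th x).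

Definition T_P S (P : set (rule S)) (I : set (atom S)) : set (atom S) :=
  [set A | exists r th, [/\ P r, ground_subst th,
     forall B, B \in rbody r -> I (subst_atom th B)
   & A = subst_atom th (rhead r)]].

Definition T_P_iter S (P : set (rule S)) (i : nat) : set (atom S) :=
  iter i (T_P P) set0.

(* The body condition records that the fact is inferred by means of [r]
   itself: an instance of the head of [r] that is only ever derived by other
   rules does not count. *)
Definition facts_inferred S (P : set (rule S)) (r : rule S) : set (atom S) :=
  [set A | exists i th, [/\ 1 <= i, ground_subst th,
     forall B, B \in rbody r -> T_P_iter P i.-1 (subst_atom th B),
     A = subst_atom th (rhead r)
   & (T_P_iter P i `\` T_P_iter P i.-1) A]].

Definition range_restricted S (r : rule S) : Prop :=
  forall x, occurs_atom x (rhead r) -> has (occurs_atom x) (rbody r).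

Definition at_most_one_complex S (r : rule S) : Prop :=
  forall x (i : 'I_(parity (apred (rhead r)))) (B : atom S)
         (j : 'I_(parity (apred B))),
    B \in rbody r ->
    occurs x (aargs (rhead r) i) -> occurs x (aargs B j) ->
    ~ (complex (aargs (rhead r) i) /\ complex (aargs B j)).

Definition nesting_at_most_one S (r : rule S) : Prop :=
  forall (A : atom S) (i : 'I_(parity (apred A))),
    A \in rhead r :: rbody r ->
    complex (aargs A i) -> depth (aargs A i) <= 1.

Definition unifies_via S (th : substitution S) (A B : atom S) : Prop :=
  subst_atom th A = subst_atom th B.

Definition variant S (r r' : rule S) : Prop :=
  exists rho : nat -> nat,
    injective rho /\ r' = subst_rule (fun x => Var (rho x)) r.

Definition apart S (r s : rule S) : Prop :=
  forall x, ~ (occurs_rule x r /\ occurs_rule x s).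

(* Unification between rules is always understood up to renaming the rules
   apart; in particular a rule is renamed apart from itself. *)
Definition Sigma S (P : set (rule S)) (r s : rule S) : Prop :=
  [/\ P r, P s &
   exists r' s', [/\ variant r r', variant s s', apart r' s' &
     exists th B, B \in rbody s' /\ unifies_via th (rhead r') B]].

(* The path is p 1, ..., p k.+1, with renamed-apart copies q 1, ..., q k.+1
   and unifiers th 1, ..., th k; other values are irrelevant. *)
Definition active_path S (P : set (rule S)) (k : nat) (p : nat -> rule S) :
    Prop :=
  (forall i, 1 <= i <= k -> Sigma P (p i) (p i.+1)) /\
  exists (q : nat -> rule S) (th : nat -> substitution S),
    [/\ forall i, 1 <= i <= k.+1 -> variant (p i) (q i),
        forall i j, 1 <= i <= k.+1 -> 1 <= j <= k.+1 -> i <> j ->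
          apart (q i) (q j),
        exists B, B \in rbody (q 2) /\ unifies_via (th 1) (rhead (q 1)) B
      & forall i, 2 <= i <= k ->
          exists B, B \in rbody (q i.+1) /\
            unifies_via (th i) (subst_atom (th i.-1) (rhead (q i))) B].

Definition Sigma_k S (P : set (rule S)) (k : nat) (r s : rule S) : Prop :=
  [/\ P r, P s &
   exists p, [/\ active_path P k p, p 1 = r & p k.+1 = s]].

Definition depends_on_cycle S (E : rule S -> rule S -> Prop) (r : rule S) :
    Prop :=
  let e : rel (rule S) := fun x y => `[< E x y >] in
  exists c : seq (rule S), [/\ c != [::], cycle e c &
    exists x p, [/\ x \in c, path e x p & last x p = r]].

(* Main.v *)
(** Range restriction makes every [T_P_iter P n] finite, so an infinite
    [facts_inferred P r] contains facts appearing first at arbitrarily late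
    stages.  A fact first derived at stage [n.+1] uses a body fact first derived
    at stage [n]; descending gives a chain of [n.+1] ground rule instances ending
    in [r].  The ground substitutions along the chain, glued together on
    renamed-apart copies of the rules, unify all consecutive heads and body atoms
    at once, so every segment of length [k] is an active path.  A chain longer
    than [k] times the number of rules then repeats a rule along [Sigma_k]. *)
Require Import Defs.
From mathcomp Require Import all_boot.
From mathcomp Require Import boolp classical_sets cardinality.

Set Implicit Arguments.
Unset Strict Implicit.
Unset Printing Implicit Defensive.

Local Open Scope classical_set_scope.

(** * Agreement, composition and renaming of substitutions *)

Section Substitutions.
Variable S : signature.
Implicit Types (t : term S) (A B : atom S) (th : substitution S).

(* Injectivity of [App f] and [Atom p] in their dependent arguments is obtained
   by projecting to the [n]-th argument, which needs no uniqueness of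
   identity proofs. *)
Definition term_arg t (n : nat) : option (term S) :=
  if t is App _ a then omap a (insub n) else None.

Definition atom_arg A (n : nat) : option (term S) := omap (aargs A) (insub n).

Lemma App_inj f (a b : {ffun 'I_(farity f) -> term S}) :
  App f a = App f b -> a =1 b.
Proof.
move=> ab i; have := congr1 (term_arg ^~ i) ab.
by rewrite /= valK => -[].
Qed.

Lemma subst_atom_arg th th' A i :
  subst_atom th A = subst_atom th' A ->
  subst th (aargs A i) = subst th' (aargs A i).
Proof.
move=> AA'; have := congr1 (atom_arg ^~ i) AA'.
by rewrite /atom_arg /= valK /= !ffunE => -[].
Qed.

Lemma eq_in_subst th th' : forall t,
  (forall x, occurs x t -> th x = th' x) -> subst th t = subst th' t.
Proof.
fix IH 1 => -[x|c|f a] /= thE //; first exact/thE/eqxx.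
congr App; apply/ffunP => i; rewrite !ffunE.
by apply: IH => x xa; apply: thE; apply/existsP; exists i.
Qed.

Lemma subst_occurs th th' x : forall t,
  subst th t = subst th' t -> occurs x t -> th x = th' x.
Proof.
fix IH 1 => -[y|c|f a] //=; first by move=> E /eqP ->.
move=> /App_inj E /existsP[i]; apply: IH.
by have := E i; rewrite !ffunE.
Qed.

Lemma subst_comp th th' : forall t,
  subst th (subst th' t) = subst (fun x => subst th (th' x)) t.
Proof.
fix IH 1 => -[x|c|f a] //=.
by congr App; apply/ffunP => i; rewrite !ffunE.
Qed.

Lemma subst_ground th t : ground t -> subst th t = t.
Proof.
move=> gt; have -> : subst th t = subst Var t.
  by apply: eq_in_subst => x xt; have := gt x; rewrite xt.
move: t {gt}; fix IH 1 => -[x|c|f a] //=.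
by congr App; apply/ffunP => i; rewrite ffunE.
Qed.

Lemma eq_in_subst_atom th th' A :
  (forall x, occurs_atom x A -> th x = th' x) ->
  subst_atom th A = subst_atom th' A.
Proof.
move=> thE; congr Atom; apply/ffunP => i; rewrite !ffunE.
by apply: eq_in_subst => x xi; apply: thE; apply/existsP; exists i.
Qed.

Lemma subst_atom_occurs th th' x A :
  subst_atom th A = subst_atom th' A -> occurs_atom x A -> th x = th' x.
Proof. by move=> E /existsP[i]; apply/subst_occurs/subst_atom_arg. Qed.

Lemma subst_atom_comp th th' A :
  subst_atom th (subst_atom th' A) = subst_atom (fun x => subst th (th' x)) A.
Proof. by congr Atom; apply/ffunP => i; rewrite !ffunE subst_comp. Qed.

(** Lets one ground substitution serve as all the unifiers of an active path, where each head
    arrives already instantiated by the previous unifier. *)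
Lemma subst_atom_idem th A :
  ground_subst th -> subst_atom th (subst_atom th A) = subst_atom th A.
Proof.
move=> gth; rewrite subst_atom_comp; apply: eq_in_subst_atom => x _.
exact: subst_ground.
Qed.

Lemma occurs_rename (rho : nat -> nat) x : forall t,
  occurs x (subst (fun y => Var (rho y)) t) -> exists y, x = rho y.
Proof.
fix IH 1 => -[y|c|f a] //=; first by move=> /eqP ->; exists y.
by move=> /existsP[i]; rewrite ffunE; apply: IH.
Qed.

Lemma occurs_rename_atom (rho : nat -> nat) x A :
  occurs_atom x (subst_atom (fun y => Var (rho y)) A) -> exists y, x = rho y.
Proof. by move=> /existsP[i]; rewrite ffunE => /occurs_rename. Qed.

Lemma occurs_rename_rule (rho : nat -> nat) x (r : rule S) :
  occurs_rule x (subst_rule (fun y => Var (rho y)) r) -> exists y, x = rho y.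
Proof.
case/orP => [/occurs_rename_atom //|].
by rewrite has_map => /hasP[B _ /occurs_rename_atom].
Qed.

End Substitutions.

(** * Finiteness of the stages of the iteration *)

Section Stages.
Variables (S : signature) (P : set (rule S)).
Implicit Types (r : rule S) (I : set (atom S)).

Lemma T_P_mono I I' : I `<=` I' -> T_P P I `<=` T_P P I'.
Proof.
move=> II' A [r [th [Pr gth body ->]]]; exists r, th; split=> // B Br.
exact/II'/body.
Qed.

Lemma T_P_iter_mono m n : m <= n -> T_P_iter P m `<=` T_P_iter P n.
Proof.
have mono1 i : T_P_iter P i `<=` T_P_iter P i.+1.
  by elim: i => [A []|i IH]; exact: T_P_mono.
elim: n => [|n IH]; first by rewrite leqn0 => /eqP ->.
rewrite leq_eqVlt => /predU1P[-> //|/IH mn].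
exact: subset_trans mn (mono1 n).
Qed.

(** An instance of [B :: s] is an element of [I] consed onto an instance of [s], so induction stays
    inside the image of a finite product. *)
Lemma finite_body_instances I (s : seq (atom S)) : finite_set I ->
  finite_set [set u | exists2 th, forall B, B \in s -> I (subst_atom th B)
                                & u = map (subst_atom th) s].
Proof.
move=> finI; elim: s => [|B s IH].
  apply: (@sub_finite_set _ _ [set [::]]); last exact: finite_set1.
  by move=> u [th _ ->].
apply: sub_finite_set (finite_image2 cons finI IH) => u [th Ith ->] /=.
exists (subst_atom th B); first by apply: Ith; rewrite mem_head.
exists (map (subst_atom th) s) => //.
by exists th => // C Cs; apply: Ith; rewrite inE Cs orbT.
Qed.

(* By range restriction the head instance is a function of the body
   instance. *)
Lemma finite_head_instances I r : finite_set I -> range_restricted r ->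
  finite_set [set A | exists2 th, forall B, B \in rbody r -> I (subst_atom th B)
                                & A = subst_atom th (rhead r)].
Proof.
move=> finI rr.
pose inst u th := map (subst_atom th) (rbody r) = u.
(* Any substitution realising [u] gives the same head; the default [rhead r] is never reached on
   actual body instances. *)
pose head u := if pselect (exists th, inst u th) is left h
               then subst_atom (sval (cid h)) (rhead r) else rhead r.
apply: sub_finite_set (finite_image head (finite_body_instances (rbody r) finI)).
move=> A [th Ith ->]; exists (map (subst_atom th) (rbody r)).
  by exists th.
rewrite /head; case: pselect => [h|[]]; last by exists th.
case: cid => th' /= /eq_in_map E; apply: eq_in_subst_atom => x /rr /hasP[B Br].
exact/subst_atom_occurs/E.
Qed.

Lemma finite_T_P_iter n : finite_set P ->
  (forall r, P r -> range_restricted r) -> finite_set (T_P_iter P n).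
Proof.
move=> finP rr; elim: n => [|n IH]; first exact: finite_set0.
apply: sub_finite_set (bigcup_finite finP (fun r Pr =>
  finite_head_instances IH (rr r Pr))).
by move=> A [r [th [Pr _ body ->]]]; exists r => //; exists th.
Qed.

End Stages.

(** * Ground derivation chains and active paths *)

Section Chains.
Variables (S : signature) (P : set (rule S)).
Implicit Types (s : nat -> rule S) (sg : nat -> substitution S).

Definition feeds s sg i : Prop :=
  exists2 B, B \in rbody (s i.+1) &
    subst_atom (sg i) (rhead (s i)) = subst_atom (sg i.+1) B.

(** The first two conditions have no bound on [i], so that substitutions glued from all the [sg i]
    are ground everywhere. *)
Definition ground_chain n s sg : Prop :=
  [/\ forall i, P (s i), forall i, ground_subst (sg i) &
      forall i, i < n -> feeds s sg i].

(** If every body instance had appeared one stage earlier, the head would not be new. Some body fact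
    is therefore new too, and the rule deriving it extends the chain backwards. *)
Lemma new_fact_chain n r th : P r -> ground_subst th ->
  (forall B, B \in rbody r -> T_P_iter P n (subst_atom th B)) ->
  ~ T_P_iter P n (subst_atom th (rhead r)) ->
  exists s sg, [/\ ground_chain n s sg, s n = r & sg n = th].
Proof.
elim: n r th => [|n IH] r th Pr gth body new.
  by exists (fun=> r), (fun=> th).
have [B Br newB] : exists2 B, B \in rbody r & ~ T_P_iter P n (subst_atom th B).
  apply: contra_notP new => noB; exists r, th; split=> // B Br.
  by apply: contra_notP noB => newB; exists B.
have [r' [th' [Pr' gth' body' E]]] := body B Br.
rewrite E in newB.
have [s [sg [[Ps gsg chain] sn sgn]]] := IH _ _ Pr' gth' body' newB.
exists (fun i => if i <= n then s i else r), (fun i => if i <= n then sg i else th).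
rewrite ltnn; split=> //; split=> [i|i|i]; [by case: ifP|by case: ifP|].
rewrite ltnS leq_eqVlt /feeds => /predU1P[->|ltin].
  by rewrite leqnn ltnn; exists B => //; rewrite sn sgn.
by rewrite (ltnW ltin) ltin; exact: chain.
Qed.

Lemma ground_chain_Sigma_k n k i s sg : ground_chain n s sg ->
  1 <= k -> i + k <= n -> Sigma_k P k (s i) (s (i + k)).
Proof.
move=> [Ps gsg chain] k1 ikn.
(* Active paths are indexed from 1, hence the predecessor. *)
pose p j := s (i + j.-1); pose tau j := sg (i + j.-1).
have feedp j : 1 <= j <= k -> exists2 B, B \in rbody (p j.+1) &
    subst_atom (tau j) (rhead (p j)) = subst_atom (tau j.+1) B.
  case: j => // j /= jk; rewrite /p /tau /= addnS; apply: chain.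
  by rewrite (leq_trans _ ikn) // ltn_add2l.
(* Coding pairs makes each [rho j] injective and their ranges disjoint. Decoding a variable tells
   which [tau j] to apply; variables that code no pair get an arbitrary ground term. *)
pose rho (j x : nat) : nat := pickle (j, x).
pose q j := subst_rule (fun x => Var (rho j x)) (p j).
pose th (y : nat) := if unpickle y is Some (j, x) then tau j x else tau 0 y.
have thrho j x : th (rho j x) = tau j x by rewrite /th /rho pickleK.
have gth : ground_subst th.
  by move=> y; rewrite /th; case: unpickle => [[j x]|]; exact: gsg.
have thq j A : subst_atom th (subst_atom (fun x => Var (rho j x)) A) =
               subst_atom (tau j) A.
  by rewrite subst_atom_comp; apply: eq_in_subst_atom => x _; exact: thrho.
have variantq j : variant (p j) (q j).
  exists (rho j); split=> // x y /(pcan_inj pickleK) [] //.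
have apartq j l : j <> l -> apart (q j) (q l).
  move=> jl x [/occurs_rename_rule[y ->] /occurs_rename_rule[z]].
  by move=> /(pcan_inj pickleK) [].
have feedq j : 1 <= j <= k -> exists B, B \in rbody (q j.+1) /\
    unifies_via th (rhead (q j)) B.
  move=> /feedp[B Bp E]; exists (subst_atom (fun x => Var (rho j.+1 x)) B).
  by split; [exact: map_f|rewrite /unifies_via !thq].
split=> //; exists p; split; [split|by rewrite /p addn0|by []].
  move=> j jk; split; [exact: Ps|exact: Ps|].
  exists (q j), (q j.+1); split=> //; first exact/apartq/n_Sn.
  by exists th; exact: feedq.
exists q, (fun=> th); split=> [//|j l _ _||j /andP[j2 jk]].
- exact: apartq.
- exact: feedq.
have [|B [Bq E]] := feedq j; first by rewrite jk ltnW.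
by exists B; split=> //; rewrite /unifies_via subst_atom_idem.
Qed.

End Chains.

(** * Cycles on long walks through finitely many rules *)

Lemma path_map_iota (T : Type) (e : rel T) (t : nat -> T) a d :
  (forall j, a <= j < a + d -> e (t j) (t j.+1)) ->
  path e (t a) (map t (iota a.+1 d)).
Proof.
elim: d a => //= d IH a et; rewrite et ?leqnn ?addnS ?ltnS ?leq_addr //=.
by apply: IH => j /andP[aj jd]; apply: et; rewrite ltnW // -addSnnS.
Qed.

Lemma last_map_iota (T : Type) (t : nat -> T) a d :
  last (t a) (map t (iota a.+1 d)) = t (a + d).
Proof. by elim: d a => [|d IH] a /=; rewrite ?addn0 // IH addSnnS. Qed.

(** By pigeonhole two of the [size V + 1] visited rules coincide; the walk between them is a cycle
    and its remainder leads to the end. *)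
Lemma long_walk_depends_on_cycle (S : signature)
    (E : rule S -> rule S -> Prop) (V : seq (rule S)) (t : nat -> rule S) :
  (forall j, t j \in V) -> (forall j, j < size V -> E (t j) (t j.+1)) ->
  depends_on_cycle E (t (size V)).
Proof.
move=> tV Et; set m := size V in Et *.
have : ~~ uniq (map t (iota 0 m.+1)).
  have tsub : {subset map t (iota 0 m.+1) <= V} by move=> _ /mapP[j _ ->].
  by apply/negP => /uniq_leq_size /(_ tsub); rewrite size_map size_iota ltnn.
case/(uniqPn (t 0)) => a [b [ab]].
rewrite size_map size_iota ltnS => bm.
rewrite !(nth_map 0) ?size_iota ?ltnS ?(leq_trans (ltnW ab)) //.
rewrite !nth_iota ?ltnS ?(leq_trans (ltnW ab)) // !add0n => tab.
pose e : rel (rule S) := fun x y => `[< E x y >].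
have et j : j < m -> e (t j) (t j.+1) by move=> jm; apply/asboolP/Et.
have [d bE] : exists d, b = a + d.+1.
  by exists (b - a.+1); rewrite -addSnnS subnKC.
(* The cycle lists [t a] up to [t b.-1]; the edge into [t b = t a] closes it. *)
exists (t a :: map t (iota a.+1 d)); split=> //.
  rewrite /= tab bE addnS -addSn -map_rcons.
  have -> : rcons (iota a.+1 d) (a.+1 + d) = iota a.+1 d.+1.
    by rewrite -[d.+1]addn1 iotaD cats1.
  rewrite addSn -addnS -bE -tab; apply: path_map_iota => j /andP[_].
  by rewrite -bE => jb; apply/et/(leq_trans jb).
exists (t a), (map t (iota b.+1 (m - b))); split; first exact: mem_head.
  rewrite tab; apply: path_map_iota => j; rewrite subnKC // => /andP[_].
  exact: et.
by rewrite tab last_map_iota subnKC.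
Qed.

Theorem theorem4 (S : signature) (P : set (rule S)) (r : rule S)
  (P_finite : finite_set P)
  (P_range_restricted : forall s, P s -> range_restricted s)
  (P_at_most_one_complex : forall s, P s -> at_most_one_complex s)
  (P_nesting : forall s, P s -> nesting_at_most_one s)
  (r_in_P : P r)
  (M_infinite : infinite_set (facts_inferred P r)) :
  forall k : nat, 1 <= k -> depends_on_cycle (Sigma_k P k) r.
Proof.
move=> k k1; have [V PV] := (finite_seqP P).1 P_finite.
(* Room for [size V] consecutive segments of length [k]. *)
pose n := k * size V.
have [A [MA late]] : exists A, facts_inferred P r A /\ ~ T_P_iter P n A.
  apply: contra_notP M_infinite => noA.
  apply: sub_finite_set (finite_T_P_iter n P_finite P_range_restricted).
  by move=> A MA; apply: contra_notP noA => late; exists A.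
case: MA => -[|i] [th [// _ gth body AE [iA new]]].
have ni : n <= i.
  by rewrite leqNgt; apply/negP => /T_P_iter_mono lein; apply/late/lein.
rewrite AE in new.
have [s [sg [chain <- _]]] := new_fact_chain r_in_P gth body new.
(* Every [k]-th rule among the last [n] steps, offset so that the walk ends exactly at [s i], which
   is the given rule. *)
pose t j := s (i - n + k * j).
have -> : s i = t (size V) by rewrite /t subnK.
apply: long_walk_depends_on_cycle => [j|j jV].
  by case: chain => Ps _ _; have := Ps (i - n + k * j); rewrite PV.
rewrite /t mulnS [k + _]addnC addnA; apply: (ground_chain_Sigma_k chain k1).
by rewrite -addnA -mulnSr -[leqRHS](subnK ni) leq_add2l leq_mul2l jV orbT.
Qed.
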